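(* Let $S$ be a four-holed sphere with a pants decomposition and dual graph, with eigenvalue parameters $e_1,\dots,e_5$ and twist parameter $t_1$ as described in the context. The action of $(\mathbb{Z}/2\mathbb{Z})^5$ (generated by the changes of choice $e_i\to e_i^{-1}$) on the eigenvalue and twist parameters is given by $$(e_1\to e_1^{-1})\cdot(e_1,t_1)=(e_1^{-1},t_1^{-1}),$$ $$(e_2\to e_2^{-1})\cdot(e_2,t_1)=\Bigl(e_2^{-1},\ \frac{e_2e_3-e_1}{1-e_1e_2e_3}\cdot\frac{e_1e_3-e_2}{e_1e_2-e_3}\,t_1\Bigr),$$ $$(e_3\to e_3^{-1})\cdot(e_3,t_1)=(e_3^{-1},t_1),$$ $$(e_4\to e_4^{-1})\cdot(e_4,t_1)=(e_4^{-1},t_1),$$ $$(e_5\to e_5^{-1})\cdot(e_5,t_1)=\Bigl(e_5^{-1},\ \frac{e_4e_5-e_1}{1-e_1e_4e_5}\cdot\frac{e_1e_4-e_5}{e_1e_5-e_4}\,t_1\Bigr),$$ where the parameters not written are unchanged. If the orientation of the boundary edge corresponding to $e_i$ ($i=2,3,4,5$) is reversed (inward), the same holds with $e_i$ replaced by $e_i^{-1}$ in the coefficients of $t_1$.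
   Context: Setting. $S$ is an oriented four-holed sphere, $\pi_1(S)=\langle\gamma_1,\dots,\gamma_5\mid\gamma_1\gamma_2\gamma_3=1,\ \gamma_1^{-1}\gamma_4\gamma_5=1\rangle$, where $\gamma_2,\dots,\gamma_5$ go around the four boundary components and $\gamma_1$ around the interior pants curve, which cuts $S$ into pairs of pants $P_1$ (with $\pi_1$ generated by $\gamma_1,\gamma_2,\gamma_3$) and $P_2$ (generated by $\gamma_1,\gamma_4,\gamma_5$). The dual graph has an interior edge $f_1$ oriented from $P_1$ to $P_2$ and boundary edges $f_2,\dots,f_5$, oriented outward unless said otherwise; the counterclockwise orders at its trivalent vertices are $(f_1,f_2,f_3)$ in $P_1$ and $(f_1,f_4,f_5)$ in $P_2$. $\rho:\pi_1(S)\to\mathrm{SL}(2,\mathbb{C})$ is a representation such that each $\rho(\gamma_i)$ has exactly two fixed points on $\mathbb{C}P^1$ and the restrictions of $\rho$ to $\langle\gamma_1,\gamma_2,\gamma_3\rangle$ and $\langle\gamma_1,\gamma_4,\gamma_5\rangle$ are irreducible (no common fixed point in $\mathbb{C}P^1$). The eigenvalue parameter $e_i$ is a chosen eigenvalue of $\rho(\gamma_i)$; $x_i$ (resp. $y_i$) is the fixed point given by the eigenvector for $e_i$ (resp. $e_i^{-1}$); for a boundary edge $f_i$ oriented inward, $x_i$ is instead the fixed point for $e_i^{-1}$. The twist parameter $t_1\in\mathbb{C}^*$ is the unique number such that the matrix with eigenvalue $\sqrt{-t_1}$ at $x_1$ and $1/\sqrt{-t_1}$ at $y_1$ sends $x_2$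 to $x_5$, i.e. $-t_1=\frac{(x_1-x_2)(y_1-x_5)}{(x_1-x_5)(y_1-x_2)}$. The element $(e_i\to e_i^{-1})$ replaces the choice of eigenvalue $e_i$ by $e_i^{-1}$ (so $x_i$ and $y_i$ are exchanged), and $t_1$ by the twist parameter of the same representation $\rho$ computed with the new choice. *)

(* Defs.v *)
From HB Require Import structures.
From mathcomp Require Import all_boot all_order all_algebra.
From mathcomp Require Import reals complex.

Set Implicit Arguments.
Unset Strict Implicit.
Unset Printing Implicit Defensive.

Import GRing.Theory Num.Theory.
Local Open Scope ring_scope.

(* The index [fk] stands for both the curve gamma_k and the dual edge f_k:
   [f1] is the interior edge, [f2], ..., [f5] are the boundary edges. *)
Definition f1 : 'I_5 := @Ordinal 5 0 isT.
Definition f2 : 'I_5 := @Ordinal 5 1 isT.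
Definition f3 : 'I_5 := @Ordinal 5 2 isT.
Definition f4 : 'I_5 := @Ordinal 5 3 isT.
Definition f5 : 'I_5 := @Ordinal 5 4 isT.

Definition sphere_relations (G : groupType) (g : 'I_5 -> G) : Prop :=
  (g f1 * g f2 * g f3 = 1 /\ (g f1)^-1 * g f4 * g f5 = 1)%g.

(* (G, g) is the group < gamma_1, ..., gamma_5 | the two relations >: it
   satisfies the relations and is universal among groups that do. *)
Definition is_pi1_four_holed_sphere (G : groupType) (g : 'I_5 -> G) : Prop :=
  sphere_relations g /\
  forall (H : groupType) (h : 'I_5 -> H), sphere_relations h ->
    exists phi : {multiplicative G -> H},
      (forall i, phi (g i) = h i) /\
      forall psi : {multiplicative G -> H},
        (forall i, psi (g i) = h i) -> psi =1 phi.

Inductive generated (G : groupType) (A : seq G) : G -> Prop :=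
| generated_mem x of x \in A : generated A x
| generated_one : generated A 1%g
| generated_mul x y of generated A x & generated A y : generated A (x * y)%g
| generated_inv x of generated A x : generated A (x^-1)%g.

Section FourHoledSphere.

Variable R : realType.
Local Notation C := (R[i]).

(* Points of CP^1 are the subspaces L of C^2 (column vectors) with
   \dim L = 1; matrices act on the left. *)
Definition endo (A : 'M[C]_2) : 'End('cV[C]_2) := linfun (mulmx A).

Definition fixed_point (A : 'M[C]_2) (L : {vspace 'cV[C]_2}) : Prop :=
  \dim L = 1%N /\ (endo A @: L)%VS = L.

Definition exactly_two_fixed_points (A : 'M[C]_2) : Prop :=
  exists p q : {vspace 'cV[C]_2},
    p <> q /\ forall L, fixed_point A L <-> L = p \/ L = q.

Definition SL2_representation (G : groupType) (rho : G -> 'M[C]_2) : Prop :=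
  [/\ forall x, \det (rho x) = 1, rho 1%g = 1%:M
    & forall x y, rho (x * y)%g = rho x *m rho y].

Definition irreducible_on (G : groupType) (rho : G -> 'M[C]_2)
    (K : G -> Prop) : Prop :=
  ~ exists L, forall x, K x -> fixed_point (rho x) L.

Definition admissible_representation (G : groupType) (g : 'I_5 -> G)
    (rho : G -> 'M[C]_2) : Prop :=
  [/\ SL2_representation rho,
      forall i, exactly_two_fixed_points (rho (g i)),
      irreducible_on rho (generated [:: g f1; g f2; g f3])
    & irreducible_on rho (generated [:: g f1; g f4; g f5])].

(* Used both for the definition of the fixed points and for the coefficients:
   the eigenvalue whose eigenline is x_i, when [inward] is the set of the
   inward oriented boundary edges. *)
Definition oriented (inward : {set 'I_5}) (e : {ffun 'I_5 -> C}) (i : 'I_5) : C :=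
  if i \in inward then (e i)^-1 else e i.

Section Representation.

Variables (G : groupType) (g : 'I_5 -> G) (rho : G -> 'M[C]_2).
Variable inward : {set 'I_5}.

Definition xpt (e : {ffun 'I_5 -> C}) (i : 'I_5) : {vspace 'cV[C]_2} :=
  passmx.leigenspace (endo (rho (g i))) (oriented inward e i).

Definition ypt (e : {ffun 'I_5 -> C}) (i : 'I_5) : {vspace 'cV[C]_2} :=
  passmx.leigenspace (endo (rho (g i))) (oriented inward e i)^-1.

(* The other square root of -t replaces M by -M, which acts in the same way
   on CP^1. *)
Definition twist_condition (e : {ffun 'I_5 -> C}) (t : C) : Prop :=
  t != 0 /\
  exists M : 'M[C]_2,
    [/\ (xpt e f1 <= passmx.leigenspace (endo M) (sqrtC (- t)))%VS,
        (ypt e f1 <= passmx.leigenspace (endo M) (sqrtC (- t))^-1)%VS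
      & (endo M @: xpt e f2)%VS = xpt e f5].

Definition is_twist_parameter (e : {ffun 'I_5 -> C}) (t : C) : Prop :=
  unique (twist_condition e) t.

Definition is_parameters (p : {ffun 'I_5 -> C} * C) : Prop :=
  (forall i, passmx.leigenvalue (endo (rho (g i))) (p.1 i)) /\
  is_twist_parameter p.1 p.2.

(* (Z/2Z)^5 acting on choices of eigenvalues. *)
Definition switch (eps : {ffun 'I_5 -> 'Z_2}) (e : {ffun 'I_5 -> C}) :
    {ffun 'I_5 -> C} :=
  [ffun i => if eps i == 0 then e i else (e i)^-1].

Lemma switch0 e : switch 0 e = e.
Proof. by apply/ffunP => i; rewrite !ffunE eqxx. Qed.

Lemma switchD eps eps' e : switch (eps + eps') e = switch eps (switch eps' e).
Proof.
apply/ffunP => i; rewrite !ffunE.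
by case: (eps i) (eps' i) => [[|[|]] // h1] [[|[|]] // h2] //=; rewrite invrK.
Qed.

(* [choice_action eps p q] means eps . p = q: the choice of eigenvalues is
   changed by eps, and the twist parameter is replaced by that of the same
   representation for the new choice. *)
Definition choice_action (eps : {ffun 'I_5 -> 'Z_2})
    (p q : {ffun 'I_5 -> C} * C) : Prop :=
  [/\ is_parameters p, q.1 = switch eps p.1 & is_parameters q].

End Representation.

(* The generator (e_i -> e_i^-1) of (Z/2Z)^5. *)
Definition generator (i : 'I_5) : {ffun 'I_5 -> 'Z_2} :=
  [ffun j => if j == i then 1 else 0].

Definition invert_at (i : 'I_5) (e : {ffun 'I_5 -> C}) : {ffun 'I_5 -> C} :=
  [ffun j => if j == i then (e j)^-1 else e j].

End FourHoledSphere.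

(* Main.v *)
Require Import Defs.
From mathcomp Require Import all_boot all_order all_algebra.
From mathcomp Require Import reals complex.
From mathcomp Require Import ring.

(* Write [bracket u v] for the determinant of two vectors of C^2. If u, v span
   x_1, y_1 and p, q span x_2, x_5, then - t_1 is the cross-ratio
   bracket u p * bracket v q / (bracket u q * bracket v p), whose factors do not
   vanish by irreducibility on the two pairs of pants. Exchanging u and v
   inverts it. Replacing p by an eigenvector p' of the other eigenvalue of
   rho gamma_2 multiplies it by the cross-ratio of the eigenlines of
   rho gamma_1 and rho gamma_2, and this is read off the trace of
   rho gamma_1 * rho gamma_2, which is e_3 + e_3^-1. The case of q is the same
   with gamma_1^-1, gamma_5, gamma_4. Inward edges only replace e_i by the
   eigenvalue [oriented inward e i] of x_i. *)

Import GRing.Theory Num.Theory.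
Local Open Scope ring_scope.

Set Implicit Arguments.
Unset Strict Implicit.

(** * Linear algebra in dimension two *)

Lemma ord2P (P : 'I_2 -> Prop) : P 0 -> P 1 -> forall i, P i.
Proof.
move=> P0 P1 [[|[|//]] lt_i2]; [move: P0 | move: P1];
  by congr (P _); apply: val_inj.
Qed.

Lemma lift0_ord2 : lift (0 : 'I_2) 0 = 1. Proof. exact: val_inj. Qed.
Lemma lift1_ord2 : lift (1 : 'I_2) 0 = 0. Proof. exact: val_inj. Qed.

Lemma big_ord2 (F : fieldType) (f : 'I_2 -> F) : \sum_i f i = f 0 + f 1.
Proof. by rewrite !big_ord_recl big_ord0 addr0 lift0_ord2. Qed.

Definition bracket (F : fieldType) (u v : 'cV[F]_2) : F :=
  u 0 0 * v 1 0 - u 1 0 * v 0 0.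

Lemma colP2 (F : fieldType) (u v : 'cV[F]_2) :
  u 0 0 = v 0 0 -> u 1 0 = v 1 0 -> u = v.
Proof.
by move=> h0 h1; apply/matrixP => i j; rewrite [j]ord1; move: i; exact: ord2P.
Qed.

Lemma col2_neq0 (F : fieldType) (u : 'cV[F]_2) :
  u != 0 -> (u 0 0 != 0) || (u 1 0 != 0).
Proof.
apply: contraNT; rewrite negb_or !negbK => /andP[/eqP h0 /eqP h1].
by apply/eqP; apply: colP2; rewrite ?h0 ?h1 mxE.
Qed.

Lemma mulmx2E (F : fieldType) (A : 'M[F]_2) (u : 'cV[F]_2) i :
  (A *m u) i 0 = A i 0 * u 0 0 + A i 1 * u 1 0.
Proof. by rewrite mxE big_ord2. Qed.

Lemma mxtrace2E (F : fieldType) (A : 'M[F]_2) : \tr A = A 0 0 + A 1 1.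
Proof. exact: big_ord2. Qed.

Lemma bracketC (F : fieldType) (u v : 'cV[F]_2) : bracket u v = - bracket v u.
Proof. by rewrite /bracket; ring. Qed.

Lemma bracketC_neq0 (F : fieldType) (u v : 'cV[F]_2) :
  bracket u v != 0 -> bracket v u != 0.
Proof. by rewrite bracketC oppr_eq0. Qed.

Lemma bracket_neq0 (F : fieldType) (u v : 'cV[F]_2) :
  bracket u v != 0 -> u != 0 /\ v != 0.
Proof.
by split; apply: contraNneq H => ->; rewrite /bracket !mxE ?mulr0 ?mul0r subrr.
Qed.

Lemma bracket_eq0 (F : fieldType) (u v : 'cV[F]_2) :
  u != 0 -> bracket u v = 0 -> exists k, v = k *: u.
Proof.
move=> /col2_neq0 /orP[] nz /eqP; rewrite subr_eq0 => /eqP h.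
  exists (v 0 0 / u 0 0); apply: colP2; rewrite !mxE; first by field.
  by apply: (mulfI nz); rewrite h; field.
exists (v 1 0 / u 1 0); apply: colP2; rewrite !mxE; last by field.
by apply: (mulfI nz); rewrite -h; field.
Qed.

Lemma bracket_expand (F : fieldType) (u v w : 'cV[F]_2) : bracket u v != 0 ->
  w = (bracket w v / bracket u v) *: u + (bracket u w / bracket u v) *: v.
Proof.
by rewrite /bracket => nz; apply: colP2; rewrite !mxE; field.
Qed.

Lemma det2E (F : fieldType) (A : 'M[F]_2) :
  \det A = A 0 0 * A 1 1 - A 0 1 * A 1 0.
Proof.
rewrite (expand_det_row _ 0) big_ord2 /cofactor !det_mx11 !mxE.
rewrite lift0_ord2 lift1_ord2.
by rewrite /= expr0 expr1 mul1r mulN1r mulrN.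
Qed.

Lemma mulmx_bracket (F : fieldType) (A : 'M[F]_2) (u v : 'cV[F]_2) :
  bracket (A *m u) (A *m v) = \det A * bracket u v.
Proof. by rewrite /bracket !mulmx2E det2E; ring. Qed.

(** This is Cramer's rule for the two eigenvector equations. Keeping the factor [bracket u v] on the
    left avoids division, so that later trace computations are polynomial identities. *)
Lemma eigen_entries (F : fieldType) (A : 'M[F]_2) (u v : 'cV[F]_2) (a b : F) :
  A *m u = a *: u -> A *m v = b *: v ->
  [/\ bracket u v * A 0 0 = a * (u 0 0 * v 1 0) - b * (u 1 0 * v 0 0),
      bracket u v * A 0 1 = (b - a) * (u 0 0 * v 0 0),
      bracket u v * A 1 0 = (a - b) * (u 1 0 * v 1 0)
    & bracket u v * A 1 1 = b * (u 0 0 * v 1 0) - a * (u 1 0 * v 0 0)].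
Proof.
move=> hu hv.
have eu i : A i 0 * u 0 0 + A i 1 * u 1 0 = a * u i 0 by rewrite -mulmx2E hu mxE.
have ev i : A i 0 * v 0 0 + A i 1 * v 1 0 = b * v i 0 by rewrite -mulmx2E hv mxE.
have c0 i : bracket u v * A i 0 = v 1 0 * (a * u i 0) - u 1 0 * (b * v i 0).
  by rewrite -eu -ev /bracket; ring.
have c1 i : bracket u v * A i 1 = u 0 0 * (b * v i 0) - v 0 0 * (a * u i 0).
  by rewrite -eu -ev /bracket; ring.
by rewrite !c0 !c1; split; ring.
Qed.

Lemma eigen_trace (F : fieldType) (A : 'M[F]_2) (u v : 'cV[F]_2) (a b : F) :
  bracket u v != 0 -> A *m u = a *: u -> A *m v = b *: v -> \tr A = a + b.
Proof.
move=> nz hu hv; have [e0 _ _ e1] := eigen_entries hu hv.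
by apply: (mulfI nz); rewrite mxtrace2E mulrDr e0 e1 /bracket; ring.
Qed.

Lemma eigen_det (F : fieldType) (A : 'M[F]_2) (u v : 'cV[F]_2) (a b : F) :
  bracket u v != 0 -> A *m u = a *: u -> A *m v = b *: v -> \det A = a * b.
Proof.
move=> nz hu hv; apply: (mulIf nz); rewrite -mulmx_bracket hu hv.
by rewrite /bracket !mxE; ring.
Qed.

(* The Pluecker relation turns the trace of a product of two diagonalizable
   matrices into a function of a cross-ratio of their eigenlines. *)
Lemma trace_cross_ratio (F : fieldType) (A B : 'M[F]_2)
    (u v p q : 'cV[F]_2) (a a' b b' : F) :
  A *m u = a *: u -> A *m v = a' *: v -> B *m p = b *: p -> B *m q = b' *: q ->
  bracket u q * bracket v p * (\tr (A *m B) - a * b - a' * b') =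
  bracket u p * bracket v q * (\tr (A *m B) - a * b' - a' * b).
Proof.
move=> hu hv hp hq.
have [A00 A01 A10 A11] := eigen_entries hu hv.
have [B00 B01 B10 B11] := eigen_entries hp hq.
have tr : bracket u v * bracket p q * \tr (A *m B) =
    (bracket u v * A 0 0) * (bracket p q * B 0 0)
    + (bracket u v * A 0 1) * (bracket p q * B 1 0)
    + (bracket u v * A 1 0) * (bracket p q * B 0 1)
    + (bracket u v * A 1 1) * (bracket p q * B 1 1).
  have E i : (A *m B) i i = A i 0 * B 0 i + A i 1 * B 1 i by rewrite mxE big_ord2.
  by rewrite mxtrace2E !E; ring.
apply/eqP; rewrite -subr_eq0; apply/eqP.
(* By the Pluecker relation the two trace terms combine into a single one with coefficient
   [bracket u v * bracket p q], which is the form that [tr] evaluates. *)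
transitivity (bracket u p * bracket v q * (a * b' + a' * b)
  - bracket u q * bracket v p * (a * b + a' * b')
  - bracket u v * bracket p q * \tr (A *m B)).
  by rewrite /bracket; ring.
by rewrite tr A00 A01 A10 A11 B00 B01 B10 B11 /bracket; ring.
Qed.

(** * Points of the projective line, fixed points and eigenlines *)

Local Notation lspace A a := (passmx.leigenspace (endo A) a).

Lemma endoE (R : realType) (A : 'M[R[i]]_2) v : endo A v = A *m v.
Proof. exact: lfunE. Qed.

Lemma mem_leigenspace (R : realType) (A : 'M[R[i]]_2) a v :
  (v \in lspace A a) = (A *m v == a *: v).
Proof.
by rewrite memv_ker !lfun_simp subr_eq0.
Qed.

Lemma line_eqP (F : fieldType) (u v : 'cV[F]_2) : u != 0 -> v != 0 ->
  (<[u]>%VS = <[v]>%VS) <-> bracket u v = 0.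
Proof.
move=> unz vnz; split=> [E|/(bracket_eq0 unz) [k vE]].
  have: v \in <[u]>%VS by rewrite E memv_line.
  by case/vlineP=> k ->; rewrite /bracket !mxE; ring.
have knz : k != 0 by apply: contraNneq vnz => k0; rewrite vE k0 scale0r.
by rewrite vE; apply/esym/eqP; rewrite eqEsubv -!memvE; apply/andP; split;
  apply/vlineP; [exists k | exists k^-1; rewrite scalerA mulVf ?scale1r].
Qed.

Lemma fixed_point_line (R : realType) (A : 'M[R[i]]_2) (a : R[i]) (v : 'cV[R[i]]_2) :
  v != 0 -> a != 0 -> A *m v = a *: v -> fixed_point A <[v]>%VS.
Proof.
move=> vnz anz hv; split; first by rewrite dim_vline vnz.
rewrite limg_line endoE hv.
by apply/line_eqP; rewrite ?scaler_eq0 ?negb_or ?anz //; rewrite /bracket !mxE; ring.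
Qed.

Lemma fixed_point_eigen (R : realType) (A : 'M[R[i]]_2) L : fixed_point A L ->
  exists (v : 'cV[R[i]]_2) (a : R[i]), [/\ v != 0, L = <[v]>%VS & A *m v = a *: v].
Proof.
case=> dimL AL; exists (vpick L).
have Lnz : vpick L != 0 by rewrite vpick0 -dimv_eq0 dimL.
have LE : L = <[vpick L]>%VS.
  by apply/esym/eqP; rewrite eqEdim -memvE memv_pick dim_vline Lnz dimL.
have: endo A (vpick L) \in <[vpick L]>%VS.
  by rewrite -LE; have := memv_img (endo A) (memv_pick L); rewrite AL.
by rewrite endoE => /vlineP [a hA]; exists a.
Qed.

(** A vector of the eigenspace that is not parallel to [u] would form a basis with [u]; computing
    the trace in it gives [a + a = a + b], against [a != b]. *)
Lemma leigenspace_line (R : realType) (A : 'M[R[i]]_2) (a b : R[i]) (u v : 'cV[R[i]]_2) :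
  bracket u v != 0 -> a != b -> A *m u = a *: u -> A *m v = b *: v ->
  lspace A a = <[u]>%VS.
Proof.
move=> uv ab hu hv; have [unz _] := bracket_neq0 uv.
apply/eqP; rewrite eqEsubv -memvE mem_leigenspace hu eqxx andbT.
apply/subvP => w; rewrite mem_leigenspace => /eqP hw.
have [uw0 | uw] := eqVneq (bracket u w) 0.
  by have [k ->] := bracket_eq0 unz uw0; apply/vlineP; exists k.
have := eigen_trace uw hu hw; rewrite (eigen_trace uv hu hv) => /addrI ba.
by rewrite ba eqxx in ab.
Qed.

Lemma leigenvalueP (R : realType) (A : 'M[R[i]]_2) (a : R[i]) :
  reflect (exists2 v : 'cV[R[i]]_2, v != 0 & A *m v = a *: v)
          (passmx.leigenvalue (endo A) a).
Proof.
apply: (iffP idP) => [nz | [v vnz hv]].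
  exists (vpick (lspace A a)); first by rewrite vpick0.
  by apply/eqP; rewrite -mem_leigenspace memv_pick.
apply: contraNneq vnz => sp0; have := mem_leigenspace A a v.
by rewrite sp0 memv0 hv eqxx => ->.
Qed.

(** The two fixed lines supply an eigenbasis, whose eigenvalues are inverse to each other because
    the determinant is 1. Were they equal, the matrix would be scalar and the line of [u + v] would
    be a third fixed point. *)
Lemma two_fixed_points_eigen (R : realType) (A : 'M[R[i]]_2) (a : R[i]) :
  \det A = 1 -> exactly_two_fixed_points A ->
  passmx.leigenvalue (endo A) a ->
  exists u v : 'cV[R[i]]_2, [/\ bracket u v != 0, A *m u = a *: u, A *m v = a^-1 *: v,
                  a != 0 & a != a^-1].
Proof.
move=> detA [p [q [pq fixA]]] /leigenvalueP [w wnz hw].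
have /fixed_point_eigen [u [b [unz pE hu]]] : fixed_point A p by apply/fixA; left.
have /fixed_point_eigen [v [b' [vnz qE hv]]] : fixed_point A q by apply/fixA; right.
have uv : bracket u v != 0.
  by apply/eqP => uv0; apply: pq; rewrite pE qE; apply/line_eqP.
have bb' : b * b' = 1 by rewrite -(eigen_det uv hu hv).
have bnz : b != 0 by apply: contra_eq_neq bb' => ->; rewrite mul0r eq_sym oner_eq0.
have b'E : b' = b^-1 by rewrite -[LHS](mulKf bnz) bb' mulr1.
have b'nz : b' != 0 by rewrite b'E invr_eq0.
have bneq : b != b'.
  apply/eqP => bE; rewrite -bE in hv.
  have huv : A *m (u + v) = b *: (u + v) by rewrite mulmxDr hu hv scalerDr.
  have uuv : bracket u (u + v) = bracket u v by rewrite /bracket !mxE; ring.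
  have vuv : bracket v (u + v) = - bracket u v by rewrite /bracket !mxE; ring.
  have nz : u + v != 0.
    by apply: contraNneq uv => uv0; rewrite -uuv uv0 /bracket !mxE !mulr0 subrr.
  have /fixA := fixed_point_line nz bnz huv.
  rewrite pE qE => -[] /esym /line_eqP => [/(_ unz nz)|/(_ vnz nz)] /eqP.
    by rewrite uuv (negPf uv).
  by rewrite vuv oppr_eq0 (negPf uv).
(* It remains to see which of the two eigenvalues is [a]: that of [u] if [w] is parallel to [u], and
   otherwise that of [v], by comparing traces in the bases [u, v] and [u, w]. *)
have [uw0 | uw] := eqVneq (bracket u w) 0.
  have [k wE] := bracket_eq0 unz uw0.
  have aE : a = b.
    apply/eqP; rewrite -subr_eq0; move/eqP: hw; rewrite wE -scalemxAr hu.
    rewrite !scalerA -subr_eq0 -scalerBl scaler_eq0 (negPf unz) orbF.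
    rewrite [k * b]mulrC -mulrBl mulf_eq0 => /orP[|/eqP k0].
      by rewrite -opprB oppr_eq0.
    by move: wnz; rewrite wE k0 scale0r eqxx.
  by exists u, v; rewrite aE -b'E.
have := eigen_trace uw hu hw; rewrite (eigen_trace uv hu hv) => /addrI <-.
have bE : b'^-1 = b by rewrite b'E invrK.
by exists v, u; rewrite bE; split=> //; [exact: bracketC_neq0 | rewrite eq_sym].
Qed.

(** * The twist parameter as a cross-ratio *)

Lemma eigen_matrix_exists (F : fieldType) (u v : 'cV[F]_2) (a b : F) :
  bracket u v != 0 -> exists M : 'M[F]_2, M *m u = a *: u /\ M *m v = b *: v.
Proof.
move=> uv.
(* The entries are those forced by Cramer's rule, as in [eigen_entries]. *)
exists (\matrix_(i, j) ((if j == 0 then v 1 0 * (a * u i 0) - u 1 0 * (b * v i 0)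
   else u 0 0 * (b * v i 0) - v 0 0 * (a * u i 0)) / bracket u v)).
by move: uv; rewrite /bracket => uv; split; apply: colP2;
  rewrite mulmx2E !mxE /=; field.
Qed.

(** Expanding [p] in the basis [u, v] shows that [bracket (M *m p) q] is a nonzero multiple of the
    difference of the two sides. With [s ^+ 2 = - t] this turns the matrix condition on the twist
    into a cross-ratio. *)
Lemma line_image (R : realType) (M : 'M[R[i]]_2) (s : R[i])
    (u v p q : 'cV[R[i]]_2) :
  bracket u v != 0 -> bracket u p != 0 -> q != 0 -> s != 0 ->
  M *m u = s *: u -> M *m v = s^-1 *: v ->
  (endo M @: <[p]>)%VS = <[q]>%VS <->
  s ^+ 2 * (bracket u q * bracket v p) = bracket u p * bracket v q.
Proof.
move=> uv up qnz snz hu hv; rewrite limg_line endoE.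
have Mp : M *m p = (s * (bracket p v / bracket u v)) *: u
                 + (s^-1 * (bracket u p / bracket u v)) *: v.
  rewrite {1}(bracket_expand p uv) mulmxDr -!scalemxAr hu hv !scalerA.
  by rewrite ![_ / _ * _]mulrC.
(* This bracket is nonzero, so [M *m p] spans a genuine line. *)
have uMp : bracket u (M *m p) = s^-1 * bracket u p.
  rewrite Mp; transitivity (s^-1 * (bracket u p / bracket u v) * bracket u v).
    by rewrite /bracket !mxE; ring.
  by field; rewrite snz uv.
have [_ Mpnz] : u != 0 /\ M *m p != 0.
  by apply: bracket_neq0; rewrite uMp mulf_neq0 ?invr_eq0.
rewrite (line_eqP Mpnz qnz).
have -> : bracket (M *m p) q =
    (bracket u p * bracket v q - s ^+ 2 * (bracket u q * bracket v p))
    / (s * bracket u v).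
  rewrite Mp (bracketC p v).
  transitivity ((s * (- bracket v p / bracket u v)) * bracket u q
                 + (s^-1 * (bracket u p / bracket u v)) * bracket v q).
    by rewrite /bracket !mxE; ring.
  by field; rewrite snz uv.
split=> [/eqP | ->]; last by rewrite subrr mul0r.
by rewrite mulf_eq0 invr_eq0 mulf_eq0 (negPf snz) (negPf uv) !orbF subr_eq0 => /eqP.
Qed.

(* The sign makes it the twist parameter itself: [- t1] is the cross-ratio. *)
Definition cross_twist (F : fieldType) (u v p q : 'cV[F]_2) : F :=
  - (bracket u p * bracket v q / (bracket u q * bracket v p)).

Lemma cross_twist_swapl (F : fieldType) (u v p q : 'cV[F]_2) :
  cross_twist v u p q = (cross_twist u v p q)^-1.
Proof.
rewrite /cross_twist invrN invf_div; congr (- (_ / _)); exact: mulrC.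
Qed.

(** The factor does not involve [q]: when [p] and [p'] are eigenvectors of rho gamma_2, it depends
    on the pair of pants P_1 alone. The next lemma does the same for P_2. *)
Lemma cross_twist_change3 (F : fieldType) (u v p p' q : 'cV[F]_2) :
  bracket u p != 0 -> bracket v p != 0 ->
  bracket v p' != 0 -> bracket u q != 0 ->
  cross_twist u v p' q =
  bracket u p' * bracket v p / (bracket u p * bracket v p') * cross_twist u v p q.
Proof.
by move=> up vp vp' uq; rewrite /cross_twist; field; rewrite up vp vp' uq.
Qed.

Lemma cross_twist_change4 (F : fieldType) (u v p q q' : 'cV[F]_2) :
  bracket v p != 0 -> bracket u q != 0 ->
  bracket v q != 0 -> bracket u q' != 0 ->
  cross_twist u v p q' =
  bracket v q' * bracket u q / (bracket v q * bracket u q') * cross_twist u v p q.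
Proof.
by move=> vp uq vq uq'; rewrite /cross_twist; field; rewrite vp uq vq uq'.
Qed.

(** Since the brackets do not vanish, the equation of [line_image] is linear in the twist with
    exactly one solution, and that solution is nonzero. Only the square of [sqrtC (- t)] matters. *)
Lemma is_twist_parameterP (R : realType) (G : groupType) (g : 'I_5 -> G)
    (rho : G -> 'M[R[i]]_2) inward e t (u v p q : 'cV[R[i]]_2) :
  xpt g rho inward e f1 = <[u]>%VS -> ypt g rho inward e f1 = <[v]>%VS ->
  xpt g rho inward e f2 = <[p]>%VS -> xpt g rho inward e f5 = <[q]>%VS ->
  bracket u v != 0 -> bracket u p != 0 -> bracket v p != 0 ->
  bracket u q != 0 -> bracket v q != 0 ->
  is_twist_parameter g rho inward e t <-> t = cross_twist u v p q.
Proof.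
move=> xu yv xp xq uv up vp uq vq.
have [_ qnz] := bracket_neq0 uq.
have den : bracket u q * bracket v p != 0 by rewrite mulf_neq0.
have condP t' : twist_condition g rho inward e t' <-> t' = cross_twist u v p q.
  have sK : sqrtC (- t') ^+ 2 = - t' := sqrtCK _.
  have snz : t' != 0 -> sqrtC (- t') != 0 by rewrite sqrtC_eq0 oppr_eq0.
  rewrite /twist_condition xu yv xp xq; split.
    case=> t'nz [M []]; rewrite -!memvE !mem_leigenspace => /eqP hu /eqP hv.
    move/(line_image uv up qnz (snz t'nz) hu hv); rewrite sK => E.
    by rewrite /cross_twist -E mulfK ?opprK.
  move=> E; have t'nz : t' != 0.
    by rewrite E oppr_eq0 !mulf_neq0 ?invr_eq0.
  split=> //.
  have [M [hu hv]] := eigen_matrix_exists (sqrtC (- t')) (sqrtC (- t'))^-1 uv.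
  exists M; rewrite -!memvE !mem_leigenspace hu hv !eqxx; split=> //.
  apply/(line_image uv up qnz (snz t'nz) hu hv).
  by rewrite sK E opprK divfK.
split=> [[/condP] // | ->]; split; first exact/condP.
by move=> t' /condP.
Qed.

(** * Representations of the pairs of pants *)

Lemma representation_inv_eigen (R : realType) (G : groupType)
    (rho : G -> 'M[R[i]]_2) x (v : 'cV[R[i]]_2) (a : R[i]) :
  SL2_representation rho -> v != 0 -> rho x *m v = a *: v ->
  a != 0 /\ rho (x^-1)%g *m v = a^-1 *: v.
Proof.
case=> _ rho1 rhoM vnz hv.
have vE : v = a *: (rho (x^-1)%g *m v).
  by rewrite scalemxAr -hv mulmxA -rhoM mulVg rho1 mul1mx.
have anz : a != 0 by apply: contraNneq vnz => a0; rewrite vE a0 scale0r.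
by split=> //; rewrite {2}vE scalerA mulVf ?scale1r.
Qed.

Lemma generated_eigen (R : realType) (G : groupType)
    (rho : G -> 'M[R[i]]_2) A (v : 'cV[R[i]]_2) :
  SL2_representation rho -> v != 0 ->
  (forall x, x \in A -> exists a, rho x *m v = a *: v) ->
  forall x, generated A x -> exists a, rho x *m v = a *: v.
Proof.
move=> rep vnz hA x; elim=> {x} [x /hA // | | x y _ [a ha] _ [b hb] | x _ [a ha]].
- by case: rep => _ -> _; exists 1; rewrite mul1mx scale1r.
- case: rep => _ _ ->; exists (b * a).
  by rewrite -mulmxA hb -scalemxAr ha scalerA.
by exists a^-1; case: (representation_inv_eigen rep vnz ha).
Qed.

(** If [u] and [p] were parallel, their common line would be fixed by [x] and [y], hence by the
    whole subgroup generated by [A]. *)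
Lemma irreducible_bracket (R : realType) (G : groupType)
    (rho : G -> 'M[R[i]]_2) A x y (a b : R[i]) (u p : 'cV[R[i]]_2) :
  SL2_representation rho -> irreducible_on rho (generated A) ->
  (forall z, z \in A -> generated [:: x; y] z) ->
  u != 0 -> p != 0 -> rho x *m u = a *: u -> rho y *m p = b *: p ->
  bracket u p != 0.
Proof.
move=> rep irr gen unz pnz hu hp; apply/eqP => up; apply: irr.
have pu : rho y *m u = b *: u.
  have [|k ->] := @bracket_eq0 _ p u pnz; first by rewrite bracketC up oppr0.
  by rewrite -scalemxAr hp !scalerA mulrC.
exists <[u]>%VS => z Az.
have [c hc] : exists c, rho z *m u = c *: u.
  apply: (generated_eigen rep unz _ Az) => w /gen.
  apply: generated_eigen => // w'; rewrite !inE => /orP[] /eqP ->.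
    by exists a.
  by exists b.
by apply: (fixed_point_line unz _ hc); case: (representation_inv_eigen rep unz hc).
Qed.

Lemma representation_trace (R : realType) (G : groupType)
    (rho : G -> 'M[R[i]]_2) x y z (c : R[i]) (q r : 'cV[R[i]]_2) :
  SL2_representation rho -> (x * y * z)%g = 1%g -> bracket q r != 0 ->
  rho z *m q = c *: q -> rho z *m r = c^-1 *: r ->
  \tr (rho x *m rho y) = c + c^-1.
Proof.
move=> rep xyz qr hq hr; have [qnz rnz] := bracket_neq0 qr.
have [_ hq'] := representation_inv_eigen rep qnz hq.
have [_ hr'] := representation_inv_eigen rep rnz hr.
case: (rep) => _ _ rhoM.
have -> : rho x *m rho y = rho (z^-1)%g.
  by rewrite -rhoM; congr rho; rewrite -[LHS](mulgK z) xyz mul1g.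
by rewrite (eigen_trace qr hq' hr') invrK addrC.
Qed.

(** Here [c + c^-1] is the trace of the product. After multiplication by [a * b * c], the
    coefficient of [X] factors as [(1 - a * b * c) * (a * b - c)] and that of [Y] as
    [(b * c - a) * (a * c - b)]. *)
Lemma cross_ratio_solve (F : fieldType) (a b c X Y : F) :
  a != 0 -> b != 0 -> c != 0 -> a != a^-1 -> b != b^-1 -> Y != 0 ->
  X * (c + c^-1 - a * b - a^-1 * b^-1) = Y * (c + c^-1 - a * b^-1 - a^-1 * b) ->
  X / Y = (b * c - a) / (1 - a * b * c) * ((a * c - b) / (a * b - c)).
Proof.
move=> anz bnz cnz aV bV Ynz E.
(* If this vanished, [E] would make both coefficients zero, yet they differ by
   [(a - a^-1) * (b - b^-1)]. *)
have nz : (1 - a * b * c) * (a * b - c) != 0.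
  apply/eqP => z0.
  have K : c + c^-1 - a * b - a^-1 * b^-1 = 0.
    transitivity ((1 - a * b * c) * (a * b - c) / (a * b * c)); last by rewrite z0 mul0r.
    by field; rewrite anz bnz cnz.
  move/eqP: E; rewrite K mulr0 eq_sym mulf_eq0 (negPf Ynz) /= => /eqP E.
  have /eqP : (a - a^-1) * (b - b^-1) = 0.
    rewrite -[RHS](subrr 0) -{1}E -K; ring.
  by rewrite mulf_eq0 !subr_eq0 (negPf aV) (negPf bV).
move: (nz); rewrite mulf_eq0 negb_or => /andP[nz1 nz2].
apply: (mulIf nz); apply: (mulIf Ynz); apply: (mulIf (invr_neq0 (mulf_neq0 (mulf_neq0 anz bnz) cnz))).
transitivity (X * (c + c^-1 - a * b - a^-1 * b^-1)).
  by field; rewrite anz bnz cnz Ynz.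
by rewrite E; field; rewrite anz bnz cnz nz1 nz2.
Qed.

(** * The action of the generators *)

Lemma oriented_invert_at (R : realType) inward (e : {ffun 'I_5 -> R[i]}) j i :
  oriented inward (invert_at j e) i =
  if i == j then (oriented inward e i)^-1 else oriented inward e i.
Proof. by rewrite /oriented /invert_at ffunE; case: eqP; case: ifP. Qed.

Lemma switch_generator (R : realType) j (e : {ffun 'I_5 -> R[i]}) :
  switch (generator j) e = invert_at j e.
Proof. by apply/ffunP => i; rewrite !ffunE; case: (i == j). Qed.

(** Leaves only a twist parameter to compute for each generator: the inverse of an eigenvalue is
    again an eigenvalue because the determinant is 1. *)
Lemma choice_action_generator (R : realType) (G : groupType) (g : 'I_5 -> G)
    (rho : G -> 'M[R[i]]_2) (inward : {set 'I_5}) e (t t' : R[i]) j :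
  admissible_representation g rho -> is_parameters g rho inward (e, t) ->
  is_twist_parameter g rho inward (invert_at j e) t' ->
  choice_action g rho inward (generator j) (e, t) (invert_at j e, t').
Proof.
move=> [[detrho _ _] two _ _] par twist'; have [eig _] := par.
split; [exact: par | exact/esym/switch_generator | split; last exact: twist'].
move=> i; rewrite ffunE; case: ifP => _; last exact: eig.
have [u [v [uv _ hv _ _]]] := two_fixed_points_eigen (detrho _) (two i) (eig i).
by apply/leigenvalueP; exists v; [case: (bracket_neq0 uv) |].
Qed.

Set Strict Implicit.
Unset Implicit Arguments.

Theorem theorem9p1 (R : realType) (G : groupType) (g : 'I_5 -> G)
    (rho : G -> 'M[R[i]]_2) (inward : {set 'I_5})
    (e : {ffun 'I_5 -> R[i]}) (t1 : R[i]) :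
  is_pi1_four_holed_sphere g ->
  admissible_representation g rho ->
  f1 \notin inward ->
  is_parameters g rho inward (e, t1) ->
  let act := choice_action g rho inward in
  let c := oriented inward e in
  let e1 := c f1 in let e2 := c f2 in let e3 := c f3 in
  let e4 := c f4 in let e5 := c f5 in
  [/\ act (generator f1) (e, t1) (invert_at f1 e, t1^-1),
      act (generator f2) (e, t1)
        (invert_at f2 e,
         (e2 * e3 - e1) / (1 - e1 * e2 * e3)
           * ((e1 * e3 - e2) / (e1 * e2 - e3)) * t1),
      act (generator f3) (e, t1) (invert_at f3 e, t1),
      act (generator f4) (e, t1) (invert_at f4 e, t1)
    & act (generator f5) (e, t1)
        (invert_at f5 e,
         (e4 * e5 - e1) / (1 - e1 * e4 * e5)
           * ((e1 * e4 - e5) / (e1 * e5 - e4)) * t1)].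
Proof.
move=> [[rel1 rel2] _] adm _ par act c e1 e2 e3 e4 e5.
have [rep two irr1 irr2] := adm; have [detrho _ rhoM] := rep.
have [eig twist] := par; rewrite /= in eig twist.
(* For each i, [(w i).1] spans x_i and [(w i).2] spans y_i; for an inward edge the two eigenvectors
   are exchanged. *)
have /fin_all_exists [w W] : forall i, exists z : 'cV[R[i]]_2 * 'cV[R[i]]_2,
    [/\ bracket z.1 z.2 != 0, rho (g i) *m z.1 = c i *: z.1,
        rho (g i) *m z.2 = (c i)^-1 *: z.2, c i != 0 & c i != (c i)^-1].
  move=> i.
  have [u [v [uv hu hv nz neq]]] := two_fixed_points_eigen (detrho _) (two i) (eig i).
  rewrite /c /oriented; case: ifP => _; last by exists (u, v).
  exists (v, u); rewrite invrK invr_eq0 [_^-1 == _]eq_sym.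
  by split=> //; exact: bracketC_neq0.
have uv i : bracket (w i).1 (w i).2 != 0 by case: (W i).
have hu i : rho (g i) *m (w i).1 = c i *: (w i).1 by case: (W i).
have hv i : rho (g i) *m (w i).2 = (c i)^-1 *: (w i).2 by case: (W i).
have cnz i : c i != 0 by case: (W i).
have cV i : c i != (c i)^-1 by case: (W i).
have unz i : (w i).1 != 0 by case: (bracket_neq0 (uv i)).
have vnz i : (w i).2 != 0 by case: (bracket_neq0 (uv i)).
have lineu i : passmx.leigenspace (endo (rho (g i))) (c i) = <[(w i).1]>%VS.
  exact: leigenspace_line (uv i) (cV i) (hu i) (hv i).
have linev i : passmx.leigenspace (endo (rho (g i))) (c i)^-1 = <[(w i).2]>%VS.
  by apply: leigenspace_line (bracketC_neq0 (uv i)) _ (hv i) (hu i); rewrite eq_sym.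
have xE i : xpt g rho inward e i = <[(w i).1]>%VS := lineu i.
have yE i : ypt g rho inward e i = <[(w i).2]>%VS := linev i.
(* Inverting [e j] exchanges x_j and y_j whatever the orientation of the edge, since both operations
   are inversions of the eigenvalue. *)
have xE' j i : xpt g rho inward (invert_at j e) i =
    if i == j then <[(w i).2]>%VS else <[(w i).1]>%VS.
  by rewrite /xpt oriented_invert_at -/c; case: eqP.
have yE' j i : ypt g rho inward (invert_at j e) i =
    if i == j then <[(w i).1]>%VS else <[(w i).2]>%VS.
  by rewrite /ypt oriented_invert_at -/c; case: eqP; rewrite ?invrK.
(* In each pair of pants, gamma_1 and the curve that enters the twist (gamma_2 or gamma_5) already
   generate. *)
have gen2 z : z \in [:: g f1; g f2; g f3] -> generated [:: g f1; g f2] z.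
  rewrite !inE => /or3P[] /eqP ->; try by apply: generated_mem; rewrite !inE eqxx ?orbT.
  have -> : g f3 = ((g f1 * g f2)^-1)%g by rewrite -[LHS](mulKg (g f1 * g f2)%g) rel1 mulg1.
  by apply/generated_inv/generated_mul; apply: generated_mem; rewrite !inE eqxx ?orbT.
have gen5 z : z \in [:: g f1; g f4; g f5] -> generated [:: g f1; g f5] z.
  rewrite !inE => /or3P[] /eqP ->; try by apply: generated_mem; rewrite !inE eqxx ?orbT.
  have -> : g f4 = (g f1 * (g f5)^-1)%g.
    by rewrite -[LHS](mulKg (g f1)^-1%g) invgK -[((g f1)^-1 * _)%g](mulgK (g f5)) rel2 mul1g.
  apply: generated_mul; [|apply: generated_inv];
    by apply: generated_mem; rewrite !inE eqxx ?orbT.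
(* In these names the first letter selects the eigenvector of rho gamma_1 and the second that of rho
   gamma_2 or rho gamma_5: [u] for the first component of [w], [v] for the second. *)
have uu2 := irreducible_bracket rep irr1 gen2 (unz _) (unz _) (hu _) (hu _).
have uv2 := irreducible_bracket rep irr1 gen2 (unz _) (vnz _) (hu _) (hv _).
have vu2 := irreducible_bracket rep irr1 gen2 (vnz _) (unz _) (hv _) (hu _).
have vv2 := irreducible_bracket rep irr1 gen2 (vnz _) (vnz _) (hv _) (hv _).
have uu5 := irreducible_bracket rep irr2 gen5 (unz _) (unz _) (hu _) (hu _).
have uv5 := irreducible_bracket rep irr2 gen5 (unz _) (vnz _) (hu _) (hv _).
have vu5 := irreducible_bracket rep irr2 gen5 (vnz _) (unz _) (hv _) (hu _).
have vv5 := irreducible_bracket rep irr2 gen5 (vnz _) (vnz _) (hv _) (hv _).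
have t1E : t1 = cross_twist (w f1).1 (w f1).2 (w f2).1 (w f5).1.
  exact/(is_twist_parameterP _ (xE f1) (yE f1) (xE f2) (xE f5)
    (uv f1) uu2 vu2 uu5 vu5).
have ratio2 : bracket (w f1).1 (w f2).2 * bracket (w f1).2 (w f2).1 /
    (bracket (w f1).1 (w f2).1 * bracket (w f1).2 (w f2).2) =
    (e2 * e3 - e1) / (1 - e1 * e2 * e3) * ((e1 * e3 - e2) / (e1 * e2 - e3)).
  apply: (cross_ratio_solve (cnz f1) (cnz f2) (cnz f3) (cV f1) (cV f2) (mulf_neq0 uu2 vv2)).
  rewrite -(representation_trace rep rel1 (uv f3) (hu f3) (hv f3)).
  exact: trace_cross_ratio.
have ratio5 : bracket (w f1).2 (w f5).2 * bracket (w f1).1 (w f5).1 /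
    (bracket (w f1).2 (w f5).1 * bracket (w f1).1 (w f5).2) =
    (e4 * e5 - e1) / (1 - e1 * e4 * e5) * ((e1 * e4 - e5) / (e1 * e5 - e4)).
  rewrite [e4 * e5]mulrC [e1 * e4 * e5]mulrAC.
  apply: (cross_ratio_solve (cnz f1) (cnz f5) (cnz f4) (cV f1) (cV f5) (mulf_neq0 vu5 uv5)).
  (* A cyclic rotation of the second relation isolates gamma_4. As gamma_1 occurs inverted, its
     eigenvalue [e1] now belongs to [(w f1).2], which is why the two eigenvectors are exchanged
     compared with [ratio2]. *)
  have rel2' : (g f5 * (g f1)^-1 * g f4 = 1)%g.
    by rewrite -mulgA -[(_^-1 * _)%g](mulgK (g f5)) rel2 mul1g mulgV.
  rewrite -(representation_trace rep rel2' (uv f4) (hu f4) (hv f4)) mxtrace_mulC.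
  apply: trace_cross_ratio => //.
    by have [_] := representation_inv_eigen rep (vnz _) (hv f1); rewrite invrK.
  by have [_] := representation_inv_eigen rep (unz _) (hu f1).
have actP j t := @choice_action_generator _ _ _ _ _ _ _ t j adm par.
split; apply: actP.
- apply/(is_twist_parameterP _ (xE' f1 f1) (yE' f1 f1) (xE' f1 f2) (xE' f1 f5)
    (bracketC_neq0 (uv f1)) vu2 uu2 vu5 uu5).
  by rewrite t1E -cross_twist_swapl.
- apply/(is_twist_parameterP _ (xE' f2 f1) (yE' f2 f1) (xE' f2 f2) (xE' f2 f5)
    (uv f1) uv2 vv2 uu5 vu5).
  by rewrite -ratio2 t1E; rewrite -(cross_twist_change3 uu2 vu2 vv2 uu5).
(* The fixed points of rho gamma_3 and rho gamma_4 do not enter the cross-ratio, so [t1E] still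
   applies for both. *)
- exact/(is_twist_parameterP _ (xE' f3 f1) (yE' f3 f1) (xE' f3 f2) (xE' f3 f5)
    (uv f1) uu2 vu2 uu5 vu5).
- exact/(is_twist_parameterP _ (xE' f4 f1) (yE' f4 f1) (xE' f4 f2) (xE' f4 f5)
    (uv f1) uu2 vu2 uu5 vu5).
apply/(is_twist_parameterP _ (xE' f5 f1) (yE' f5 f1) (xE' f5 f2) (xE' f5 f5)
  (uv f1) uu2 vu2 uv5 vv5).
by rewrite -ratio5 t1E; rewrite -(cross_twist_change4 vu2 uu5 vu5 uv5).
Qed.
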